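(* Let $C$ be the ternary relation on $\mathbb{Q}$ given by $C(x,y,z)\iff (x<y<z)\vee(y<z<x)\vee(z<x<y)$. Then $\mathrm{Aut}(\mathbb{Q},C)$ has topological rank $\le 3$, but $(\mathbb{Q},C)$ has no canonical independence relation.
   Context: $\mathrm{Aut}(M)$ carries the topology of pointwise convergence. A topological group has topological rank $\le n$ if it has a dense subgroup generated by at most $n$ elements. For tuples, $a\equiv b$ means $\mathrm{tp}(a/\emptyset)=\mathrm{tp}(b/\emptyset)$ in $M$, and $a\equiv_D b$ means $\mathrm{tp}(a/D)=\mathrm{tp}(b/D)$. Juxtaposition of sets denotes union; $A\downarrow B$ means $A\downarrow_\emptyset B$. A ternary relation $A\downarrow_E B$ on finite subsets of a countable structure $M$, invariant under $\mathrm{Aut}(M)$, is a canonical independence relation (CIR) if for all finite $A,B,E,D\subseteq M$: (Stationarity over $\emptyset$) if $A\downarrow B$, $A'\downarrow B'$, $a,b,a',b'$ are tuples enumerating $A,B,A',B'$, and $a\equiv a'$, $b\equiv b'$, then $ab\equiv a'b'$; (Extension on the right) if $A\downarrow_E B$ then for every finite tuple $d$ there is $d'\equiv_{BE}d$ such that $A\downarrow_E B\cup d'$; (Transitivity on both sides) if $A\downarrow_{DE}B$ and $D\downarrow_E B$ then $AD\downarrow_E B$; and if $A\downarrow_{DE}B$ and $A\downarrow_E D$ then $A\downarrow_E BD$; (Monotonicity) if $A\downarrow_E B$, $A'\subseteq A$, $B'\subseteq B$ then $A'\downarrow_E B'$; (Existence) $A\downarrow_E E$ and $E\downarrow_E A$.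 (Neither symmetry nor base monotonicity is required.) *)

(* Defs.v *)
From HB Require Import structures.
From mathcomp Require Import all_boot all_order all_algebra finmap.
From mathcomp Require Import all_classical.
From mathcomp Require Import topology_structure product_topology.
From mathcomp Require Import initial_topology discrete_topology function_spaces.

Set Implicit Arguments.
Unset Strict Implicit.
Unset Printing Implicit Defensive.

Local Open Scope classical_set_scope.

Record language := Language {
  symbol : Type;
  arity : symbol -> nat }.

Record structure (L : language) := Structure {
  carrier :> countType;
  interp : forall s : symbol L, (arity s).-tuple carrier -> Prop }.
Arguments interp {L} M s t : rename.

(** Terms and formulas with free variables indexed by ['I_n] and with
    parameters from [P].  [Falsum], [Imp] and [All] generate the other
    connectives because satisfaction is classical. *)
Inductive term (P : Type) (n : nat) :=
| Var of 'I_n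
| Par of P.

Inductive formula (L : language) (P : Type) : nat -> Type :=
| Falsum n : formula L P n
| Eq n : term P n -> term P n -> formula L P n
| Rel n (s : symbol L) : (arity s).-tuple (term P n) -> formula L P n
| Imp n : formula L P n -> formula L P n -> formula L P n
| All n : formula L P n.+1 -> formula L P n.

Definition eval (T P : Type) (p : P -> T) n (v : n.-tuple T) (t : term P n) : T :=
  match t with Var i => tnth v i | Par c => p c end.

(** [All] binds variable 0 and shifts the other variables. *)
Fixpoint sat (L : language) (M : structure L) (P : Type) (p : P -> M) n
    (f : formula L P n) : n.-tuple M -> Prop :=
  match f with
  | Falsum _ => fun=> False
  | Eq _ t u => fun v => eval p v t = eval p v u
  | Rel _ s ts => fun v => interp M s (map_tuple (eval p v) ts)
  | Imp _ f g => fun v => sat p f v -> sat p g v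
  | All _ f => fun v => forall x : M, sat p f (cons_tuple x v)
  end.

(** The parameters of a formula over [D] are elements of the subtype [D], which
    [fsval] embeds in [M]. *)
Definition tp (L : language) (M : structure L) (D : {fset M}) n
    (a : n.-tuple M) : set (formula L D n) :=
  [set f | sat (@fsval M D) f a].
Arguments tp {L M} D {n} a.

Definition eq_tp_over (L : language) (M : structure L) (D : {fset M}) n
    (a b : n.-tuple M) : Prop := tp D a = tp D b.

Definition eq_tp (L : language) (M : structure L) n (a b : n.-tuple M) : Prop :=
  eq_tp_over fset0 a b.

HB.mixin Record isTopologicalGroup G of Group G & Topological G := {
  mulg_continuous : continuous (fun xy : G * G => (xy.1 * xy.2)%g);
  invg_continuous : continuous (fun x : G => x^-1%g) }.

#[short(type="topologicalGroupType")]
HB.structure Definition TopologicalGroup :=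
  {G of isTopologicalGroup G & Group G & Topological G}.

Definition subgroup (G : groupType) (H : set G) : Prop :=
  [/\ H 1%g, forall x y, H x -> H y -> H (x * y)%g & forall x, H x -> H x^-1%g].

Definition generated (G : groupType) (S : set G) : set G :=
  smallest (@subgroup G) S.

Definition topological_rank_le (G : topologicalGroupType) (n : nat) : Prop :=
  exists s : seq G, (size s <= n)%N /\ dense (generated [set` s]).

Section Automorphism.
Variables (L : language) (M : structure L).

Record aut := Aut {
  aut_fun :> M -> M;
  aut_inv : M -> M;
  aut_funK : cancel aut_fun aut_inv;
  aut_invK : cancel aut_inv aut_fun;
  aut_interp : forall s (t : (arity s).-tuple M),
    interp M s (map_tuple aut_fun t) <-> interp M s t }.

Lemma aut_ext (g h : aut) : g =1 h -> g = h.
Proof.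
case: g h => [f f' fK f'K fM] [g g' gK g'K gM] /= /funext fg; subst g.
have fg' : f' = g' by apply/funext => x; rewrite -[x in LHS]g'K fK.
by subst g'; congr Aut; exact: Prop_irrelevance.
Qed.

HB.instance Definition _ := gen_eqMixin aut.
HB.instance Definition _ := gen_choiceMixin aut.

Lemma id_interp s (t : (arity s).-tuple M) :
  interp M s (map_tuple id t) <-> interp M s t.
Proof. suff -> : map_tuple id t = t by [].
by apply: eq_from_tnth => i; rewrite tnth_map. Qed.

Definition aut_one : aut := Aut (fun _ => erefl) (fun _ => erefl) id_interp.

Lemma inv_interp (g : aut) s (t : (arity s).-tuple M) :
  interp M s (map_tuple (aut_inv g) t) <-> interp M s t.
Proof.
suff {2}<- : map_tuple g (map_tuple (aut_inv g) t) = t.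
  by split=> /aut_interp.
by apply: eq_from_tnth => i; rewrite !tnth_map aut_invK.
Qed.

Definition aut_invg (g : aut) : aut :=
  Aut (aut_invK g) (aut_funK g) (inv_interp g).

Lemma comp_interp (g h : aut) s (t : (arity s).-tuple M) :
  interp M s (map_tuple (g \o h) t) <-> interp M s t.
Proof.
suff -> : map_tuple (g \o h) t = map_tuple g (map_tuple h t).
  by rewrite !aut_interp.
by apply: eq_from_tnth => i; rewrite !tnth_map.
Qed.

Definition aut_mul (g h : aut) : aut :=
  Aut (can_comp (aut_funK g) (aut_funK h)) (can_comp (aut_invK h) (aut_invK g))
      (comp_interp g h).

Lemma aut_mulA : associative aut_mul. Proof. by move=> *; exact: aut_ext. Qed.
Lemma aut_mul1 : left_id aut_one aut_mul. Proof. by move=> *; exact: aut_ext. Qed.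
Lemma aut_mulr1 : right_id aut_one aut_mul. Proof. by move=> *; exact: aut_ext. Qed.
Lemma aut_mulV : left_inverse aut_one aut_invg aut_mul.
Proof. by move=> g; apply: aut_ext => x /=; exact: aut_funK. Qed.
Lemma aut_mulrV : right_inverse aut_one aut_invg aut_mul.
Proof. by move=> g; apply: aut_ext => x /=; exact: aut_invK. Qed.

HB.instance Definition _ :=
  isGroup.Build aut aut_mulA aut_mul1 aut_mulr1 aut_mulV aut_mulrV.

(** Pointwise convergence for the discrete topology on [M]. *)
Definition aut_ptws (g : aut) : {ptws discrete_topology M -> discrete_topology M} :=
  g.

HB.instance Definition _ := Topological.copy aut (initial_topology aut_ptws).

Lemma aut_near (g : aut) (x : M) : nbhs g [set h : aut | h x = g x].
Proof.
have gP : aut_ptws @ g --> aut_ptws g by exact: (@initial_continuous _ _ aut_ptws).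
have FF : Filter (aut_ptws @ g) by apply: fmap_filter; exact: nbhs_filter.
have gx := (pointwise_cvgP _ FF).1 gP x.
exact: (discrete_cvg _ _ _).1 gx.
Qed.

Lemma aut_continuous (T : topologicalType) (f : T -> aut) :
  (forall t x, nbhs t [set u | f u x = f t x]) -> continuous f.
Proof.
move=> fP; apply: (@continuous_comp_initial _ _ _ aut_ptws) => t.
by apply/pointwise_cvgP => x; apply/discrete_cvg; exact: fP.
Qed.

Lemma aut_mul_continuous : continuous (fun gh : aut * aut => (gh.1 * gh.2)%g).
Proof.
apply: aut_continuous => -[g h] x /=.
exists ([set u : aut | u (h x) = g (h x)], [set u : aut | u x = h x]).
  by split; exact: aut_near.
by case=> u v /= [ugh vh]; rewrite -ugh -vh.
Qed.

Lemma aut_inv_continuous : continuous (fun g : aut => g^-1%g).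
Proof.
apply: aut_continuous => g x /=.
apply: filterS (aut_near g (aut_inv g x)) => h /=; rewrite aut_invK => hx.
by change (aut_inv h x = aut_inv g x); rewrite -[in LHS]hx aut_funK.
Qed.

HB.instance Definition _ :=
  isTopologicalGroup.Build aut aut_mul_continuous aut_inv_continuous.

End Automorphism.

Local Open Scope fset_scope.

Definition tuple_range (T : choiceType) n (a : n.-tuple T) : {fset T} :=
  [fset x in tval a].

(** [indep A E B] stands for "[A] is independent from [B] over [E]". *)
Record is_CIR (L : language) (M : structure L)
    (indep : {fset M} -> {fset M} -> {fset M} -> Prop) : Prop := IsCIR {
  cir_invariance : forall (g : aut M) (A E B : {fset M}),
    indep [fset g x | x in A] [fset g x | x in E] [fset g x | x in B]
      <-> indep A E B;
  cir_stationarity : forall (A B A' B' : {fset M}) m n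
      (a a' : m.-tuple M) (b b' : n.-tuple M),
    indep A fset0 B -> indep A' fset0 B' ->
    tuple_range a = A -> tuple_range b = B ->
    tuple_range a' = A' -> tuple_range b' = B' ->
    eq_tp a a' -> eq_tp b b' ->
    eq_tp (cat_tuple a b) (cat_tuple a' b');
  cir_extension_right : forall A E B : {fset M}, indep A E B ->
    forall n (d : n.-tuple M), exists d' : n.-tuple M,
      eq_tp_over (B `|` E) d' d /\ indep A E (B `|` tuple_range d');
  cir_transitivity_left : forall A B D E : {fset M},
    indep A (D `|` E) B -> indep D E B -> indep (A `|` D) E B;
  cir_transitivity_right : forall A B D E : {fset M},
    indep A (D `|` E) B -> indep A E D -> indep A E (B `|` D);
  cir_monotonicity : forall A B A' B' E : {fset M},
    indep A E B -> A' `<=` A -> B' `<=` B -> indep A' E B';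
  cir_existence : forall A E : {fset M}, indep A E E /\ indep E E A }.
Arguments is_CIR {L} M indep.

Definition ternary_language : language := @Language unit (fun=> 3).

Definition circ (x y z : rat) : Prop :=
  ((x < y < z) \/ (y < z < x) \/ (z < x < y))%R.

Definition QC : structure ternary_language :=
  @Structure ternary_language rat (fun=> fun t : 3.-tuple rat =>
    circ (tnth t (@Ordinal 3 0 isT)) (tnth t (@Ordinal 3 1 isT))
         (tnth t (@Ordinal 3 2 isT))).

(* Main.v *)
Require Import Defs.
From mathcomp Require Import all_boot all_order all_algebra finmap lra.
From mathcomp Require Import all_classical topology_structure initial_topology.
From mathcomp Require Import discrete_topology function_spaces.

(** Rank.  Let [t] be the translation by 1.  By back-and-forth there is an
    automorphism [f] of [(Q, <)] that maps [x_i + k] to [y_i + k], for some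
    [k], for each pair of increasing tuples [x], [y]: a finite partial
    isomorphism is bounded, so the far translates of [x] and [y] can be added to
    it.  Then [t^-k f t^k] maps [x] to [y], so [<t, f>] is transitive on
    increasing tuples.  Add any [h] in [Aut(Q, C)] that exchanges two points;
    one comes from an isomorphism of [Q] with the sum of two copies of [Q], by
    exchanging the copies.  With [h] one can make any point of a finite set the
    least one, and two cyclically isomorphic tuples with corresponding least
    points are order isomorphic.

    No CIR.  Existence and extension give a point [c] independent from a pair of
    distinct points [x], [y].  As [xy] and [yx] have the same type, stationarity
    would give [cxy] and [cyx] the same type, but [C] holds of only one of
    them. *)

Set Implicit Arguments.
Unset Strict Implicit.
Unset Printing Implicit Defensive.

Import Order.TTheory GRing.Theory Num.Theory.

(** * Back-and-forth between dense orders without endpoints *)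

(** The generic-sequence argument: choice turns density into a step function, and step [n] of the
    recursion meets [D n]. *)
Lemma dense_chain (X : Type) (P : X -> Prop) (le : X -> X -> Prop)
    (D : nat -> X -> Prop) (x0 : X) :
    (forall x, le x x) ->
    (forall y x z, le x y -> le y z -> le x z) ->
    (forall n x, P x -> exists y, [/\ P y, le x y & D n y]) ->
    P x0 ->
  exists c : nat -> X, [/\ forall n, P (c n),
    forall m n, (m <= n)%N -> le (c m) (c n) & forall n, exists m, D n (c m)].
Proof.
move=> lexx le_trans dense_D Px0.
have step (nx : nat * {x | P x}) :
    exists y : {x | P x}, le (sval nx.2) (sval y) /\ D nx.1 (sval y).
  case: nx => n [x Px]; have [y [Py xy Dy]] := dense_D n x Px.
  by exists (exist _ y Py).
have [s sP] := choice step.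
pose c := fix c n := if n is m.+1 then s (m, c m) else exist P x0 Px0.
exists (fun n => sval (c n)); split=> [n | m n | n]; first exact: svalP.
  elim: n => [|n IHn]; first by rewrite leqn0 => /eqP->.
  rewrite leq_eqVlt => /predU1P[-> // | /IHn mn].
  by apply: le_trans mn _; exact: (sP (n, c n)).1.
by exists n.+1; exact: (sP (n, c n)).2.
Qed.

Section BackAndForth.
Local Open Scope order_scope.

Definition dense_unbounded d (T : orderType d) : Prop :=
  [/\ forall x y : T, x < y -> exists2 z, x < z & z < y,
      forall x : T, exists y, x < y & forall x : T, exists y, y < x].

Lemma interpolate d (T : orderType d) (x0 : T) (l r : seq T) :
    dense_unbounded T -> (forall x y, x \in l -> y \in r -> x < y) ->
  exists z, (forall x, x \in l -> x < z) /\ (forall y, y \in r -> z < y).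
Proof.
case=> denseT noMax noMin; elim: l => [_ | x l IHl lr].
  elim: r => [|y r [z [_ zr]]]; first by exists x0.
  have [t tzy] := noMin (Order.min z y); exists t; split=> // u.
  by move: tzy; rewrite lt_min inE => /andP[tz ty] /predU1P[-> // | /zr];
    apply: lt_trans.
have [|z [lz zr]] := IHl.
  by move=> u v ul vr; apply: lr; rewrite // inE ul orbT.
have [t [xt tr]] : exists t, x < t /\ forall y, y \in r -> t < y.
  have: forall y, y \in r -> x < y by move=> y; apply: lr; rewrite inE eqxx.
  elim: (r) => [_ | y s IHs xs]; first by have [t] := noMax x; exists t.
  have [|t [xt ts]] := IHs.
    by move=> u us; apply: xs; rewrite inE us orbT.
  have [|w xw wy] := denseT x y; first by apply: xs; rewrite inE eqxx.
  exists (Order.min t w); rewrite lt_min xt xw; split=> // u.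
  by rewrite inE gt_min => /predU1P[-> | /ts->]; rewrite ?wy ?orbT.
exists (Order.max z t); split=> u.
  by rewrite inE lt_max => /predU1P[-> | /lz->]; rewrite ?xt ?orbT.
by move=> ur; rewrite gt_max zr ?tr.
Qed.

(** A finite partial isomorphism, given by its graph. Strict inequalities suffice: by linearity they
    also make it well defined and injective. *)
Definition order_pairing d d' (A : orderType d) (B : orderType d')
    (p : seq (A * B)) : Prop :=
  {in p &, forall u v, (u.1 < v.1) = (u.2 < v.2)}.

Lemma order_pairing_sub d d' (A : orderType d) (B : orderType d')
    (p q : seq (A * B)) : {subset p <= q} -> order_pairing q -> order_pairing p.
Proof. by move=> pq qP u v /pq uq /pq vq; exact: qP. Qed.

Lemma order_pairing_eq d d' (A : orderType d) (B : orderType d')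
    (p : seq (A * B)) u v :
  order_pairing p -> u \in p -> v \in p -> (u.1 == v.1) = (u.2 == v.2).
Proof.
by move=> pP up vp; rewrite !eq_le !leNgt !(pP _ _ up vp) !(pP _ _ vp up).
Qed.

Lemma order_pairing_extl d d' (A : orderType d) (B : orderType d')
    (y0 : B) (p : seq (A * B)) (x : A) :
    dense_unbounded B -> order_pairing p ->
  exists y, order_pairing ((x, y) :: p).
Proof.
move=> denseB pP; have [xp | xp] := boolP (x \in [seq u.1 | u <- p]).
  have [[x' y] xyp ->] := mapP xp; exists y; apply: order_pairing_sub pP => u.
  by rewrite inE => /predU1P[->|].
have [|y [ly yr]] := @interpolate _ B y0
    [seq u.2 | u <- p & u.1 < x] [seq u.2 | u <- p & x < u.1] denseB.
  move=> _ _ /mapP[u + ->] /mapP[v + ->]; rewrite !mem_filter.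
  by move=> /andP[ux up] /andP[xv vp]; rewrite -pP // (lt_trans ux xv).
have ltu u : u \in p -> ((u.1 < x) = (u.2 < y)) * ((x < u.1) = (y < u.2)).
  move=> up; case: (ltgtP u.1 x) => [ux | xu | xu].
  - have u2y : u.2 < y by apply/ly/map_f; rewrite mem_filter ux.
    by rewrite u2y ltNge ltW.
  - have u2y : y < u.2 by apply/yr/map_f; rewrite mem_filter xu.
    by rewrite u2y [u.2 < y]ltNge ltW.
  - by rewrite -xu map_f in xp.
exists y => u v; rewrite !inE.
move=> /predU1P[-> | up] /predU1P[-> | vp] /=; last exact: pP.
- by rewrite !ltxx.
- by rewrite ltu.
- by rewrite ltu.
Qed.

Lemma order_pairing_swap d d' (A : orderType d) (B : orderType d')
    (p : seq (A * B)) :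
  order_pairing p -> order_pairing [seq (u.2, u.1) | u <- p].
Proof. by move=> pP _ _ /mapP[u up ->] /mapP[v vp ->] /=; rewrite pP. Qed.

Lemma order_pairing_extr d d' (A : orderType d) (B : orderType d')
    (x0 : A) (p : seq (A * B)) (y : B) :
    dense_unbounded A -> order_pairing p ->
  exists x, order_pairing ((x, y) :: p).
Proof.
move=> denseA /order_pairing_swap /(order_pairing_extl x0 y denseA)[x xP].
exists x; have /= := order_pairing_swap xP.
by rewrite -map_comp map_id_in //; case.
Qed.

(** The requirements [R] are interleaved with the usual ones, so that each is met by a finite piece
    of the graph of [f]. They let [f] be built with prescribed finite behaviour. *)
Lemma back_and_forth d d' (A : orderType d) (B : orderType d')
    (eA : nat -> A) (eB : nat -> B) (R : nat -> seq (A * B) -> Prop) :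
    (forall x, exists n, eA n = x) -> (forall y, exists n, eB n = y) ->
    dense_unbounded A -> dense_unbounded B ->
    (forall n p, order_pairing p ->
      exists q, [/\ order_pairing q, {subset p <= q} & R n q]) ->
  exists f g, [/\ cancel f g, cancel g f, {mono f : x y / x < y} &
    forall n, exists2 q, R n q & forall u, u \in q -> f u.1 = u.2].
Proof.
move=> surA surB denseA denseB extR.
pose D n (p : seq (A * B)) :=
  [/\ exists y, (eA n, y) \in p, exists x, (x, eB n) \in p & R n p].
have [||||c [cP cS cD]] := @dense_chain _ (@order_pairing _ _ A B)
  (fun p q => {subset p <= q}) D [::].
- by move=> p u.
- by move=> q p r pq qr u /pq/qr.
- move=> n p /(order_pairing_extl (eB 0%N) (eA n) denseB)[y].
  move=> /(order_pairing_extr (eA 0%N) (eB n) denseA)[x].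
  move=> /(extR n)[q [qP pq Rq]].
  exists q; split=> // [u up|]; first by apply: pq; rewrite !inE up !orbT.
  by split=> //; [exists y | exists x]; apply: pq; rewrite !inE eqxx ?orbT.
- by move=> u v; rewrite in_nil.
pose graph u := exists m, u \in c m.
have graphP u v : graph u -> graph v ->
    ((u.1 < v.1) = (u.2 < v.2)) * ((u.1 == v.1) = (u.2 == v.2)).
  move=> [m um] [n vn].
  have um' : u \in c (maxn m n) by apply: cS um; exact: leq_maxl.
  have vn' : v \in c (maxn m n) by apply: cS vn; exact: leq_maxr.
  by rewrite (cP _ _ _ um' vn') (order_pairing_eq (cP _) um' vn').
have /choice[f fP] x : exists y, graph (x, y).
  have [n <-] := surA x.
  by have [m [[y yP] _ _]] := cD n; exists y, m.
have /choice[g gP] y : exists x, graph (x, y).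
  have [n <-] := surB y.
  by have [m [_ [x xP] _]] := cD n; exists x, m.
exists f, g; split.
- by move=> x; apply/eqP; rewrite (graphP _ _ (gP _) (fP _)).2.
- by move=> y; apply/eqP; rewrite -(graphP _ _ (fP _) (gP _)).2.
- by move=> x y; rewrite (graphP _ _ (fP x) (fP y)).1.
move=> n; have [m [_ _ Rm]] := cD n; exists (c m) => // u um.
by apply/eqP; rewrite -(graphP _ u (fP _) _).2 //; exists m.
Qed.

End BackAndForth.

(** * The rational order and the sum of two copies of it *)

Local Open Scope ring_scope.

Lemma rat_dense : dense_unbounded rat.
Proof.
split=> [x y xy | x | x]; first by exists ((x + y) / 2%:R); lra.
- by exists (x + 1); lra.
- by exists (x - 1); lra.
Qed.

Definition decode (T : countType) (x0 : T) (n : nat) : T :=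
  odflt x0 (choice.unpickle n).

Lemma decode_surj (T : countType) (x0 x : T) : exists n, decode x0 n = x.
Proof. by exists (choice.pickle x); rewrite /decode choice.pickleK. Qed.

Lemma boolrat_dense : dense_unbounded (bool *l rat)%type.
Proof.
have [dense_rat noMax noMin] := rat_dense.
split=> [[b x] [c y] | [b x] | [b x]].
- rewrite ltxi_pair; case: b c => [] [] //= xy.
  + have [z xz zy] := dense_rat _ _ xy.
    by exists (true, z); rewrite ltxi_pair.
  (* The points lie in different copies; the lower copy has no last point. *)
  + have [z xz] := noMax x.
    by exists (false, z); rewrite ltxi_pair.
  + have [z xz zy] := dense_rat _ _ xy.
    by exists (false, z); rewrite ltxi_pair.
- by have [y xy] := noMax x; exists (b, y); rewrite ltxi_pair lexx.
- by have [y xy] := noMin x; exists (b, y); rewrite ltxi_pair lexx.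
Qed.

Lemma rat_seq_bound (s : seq rat) :
  exists n : nat, forall x, x \in s -> - n%:R < x < n%:R.
Proof.
exists (\sum_(x <- s) Num.bound `|x|)%N => x xs.
have le_n : (Num.bound `|x| <= \sum_(x <- s) Num.bound `|x|)%N.
  by rewrite (big_rem x) //= leq_addr.
rewrite -ltr_norml; apply: (lt_le_trans (archi_boundP (normr_ge0 _))).
by rewrite ler_nat.
Qed.

(** * Circular orders *)

Section Circular.
Local Open Scope order_scope.
Context {d : Order.disp_t} {T : orderType d}.

Definition circb (x y z : T) : bool :=
  [|| x < y < z, y < z < x | z < x < y].

(** Cutting the circle at its least point gives back the linear order, so cyclic isomorphisms that
    match least points are increasing. *)
Lemma circb_min (m x y : T) : m < x -> m < y -> circb m x y = (x < y).
Proof.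
by move=> mx my; rewrite /circb mx (lt_gtF my) andbF !orbF.
Qed.

Lemma circb_total (x y z : T) :
  x != y -> y != z -> z != x -> circb x z y = ~~ circb x y z.
Proof.
rewrite /circb.
case: (ltgtP x y); case: (ltgtP y z); case: (ltgtP z x) => //;
  by move=> zx yz xy; have := lt_trans xy (lt_trans yz zx); rewrite ltxx.
Qed.

End Circular.

Lemma circP (x y z : rat) : circ x y z <-> circb x y z.
Proof.
by rewrite /circ /circb; split=> [[|[]] -> | /or3P[]]; rewrite ?orbT; auto.
Qed.

Lemma circb_mono d d' (A : orderType d) (B : orderType d') (f : A -> B) :
    {mono f : x y / (x < y)%O} ->
  forall x y z, circb (f x) (f y) (f z) = circb x y z.
Proof. by move=> fM x y z; rewrite /circb !fM. Qed.

Definition swap_copies (u : bool *l rat) : bool *l rat := (~~ u.1, u.2).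

(** Exchanging an initial segment with the final segment that follows it only changes where the
    circle is cut. *)
Lemma circb_swap_copies (u v w : bool *l rat) :
  circb (swap_copies u) (swap_copies v) (swap_copies w) = circb u v w.
Proof.
by case: u v w => [[] x] [[] y] [[] z];
  rewrite /circb /swap_copies /= !ltxi_pair //= ?andbF ?andbT ?orbF.
Qed.

(** * The three generators *)

Definition circ_aut (f g : rat -> rat) (fK : cancel f g) (gK : cancel g f)
    (fC : forall x y z, circb (f x) (f y) (f z) = circb x y z) : aut QC.
Proof.
by refine (@Aut _ QC f g fK gK _) => -[] t; rewrite /= !tnth_map !circP fC.
Defined.

Lemma aut_circb (g : aut QC) (x y z : rat) :
  circb (g x : rat) (g y) (g z) = circb x y z.
Proof.
have := aut_interp g (s := tt) [tuple x : QC; y; z].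
rewrite /= !tnth_map !(tnth_nth (0 : rat)) /= !circP => gC.
by apply/idP/idP => /gC.
Qed.

Definition shift_aut : aut QC :=
  circ_aut (@addrK _ (1 : rat)) (subrK 1)
    (circb_mono (fun x y : rat => ltrD2r 1 x y)).

Lemma shift_autX k (x : rat) : (shift_aut ^+ k)%g x = x + k%:R.
Proof.
elim: k => [|k IHk]; first by rewrite addr0.
by rewrite expgS /= IHk -natr1 addrA.
Qed.

Lemma order_pairing_shift_cat (p q : seq (rat * rat)) :
    order_pairing p -> order_pairing q ->
  exists k : nat,
    order_pairing ([seq (u.1 + k%:R, u.2 + k%:R) | u <- p] ++ q).
Proof.
move=> pP qP.
have [k kP] :=
  rat_seq_bound ([seq u.1 | u <- p ++ q] ++ [seq u.2 | u <- p ++ q]).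
have {}kP u : u \in p ++ q -> (- k%:R < u.1 < k%:R) && (- k%:R < u.2 < k%:R).
  by move=> uP; rewrite !kP // mem_cat map_f ?orbT.
(* All coordinates lie strictly between [-k] and [k], so a shift by [2k] puts [p] entirely above [q]
   on both sides. *)
exists (k + k)%N.
have lt_qp u v : u \in q -> v \in p ->
    (u.1 < v.1 + (k + k)%:R) && (u.2 < v.2 + (k + k)%:R).
  move=> uq vp; have := kP u; have := kP v; rewrite !mem_cat uq vp orbT natrD.
  by move=> /(_ isT) + /(_ isT); lra.
move=> u v; rewrite !mem_cat.
move=> /orP[/mapP[u' u'p ->] | uq] /orP[/mapP[v' v'p ->] | vq] /=.
- by rewrite !ltrD2r pP.
- by have /andP[/lt_gtF-> /lt_gtF->] := lt_qp _ _ vq u'p.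
- by have /andP[-> ->] := lt_qp _ _ uq v'p.
- exact: qP.
Qed.

Lemma exists_shift_universal : exists f : aut QC,
  {mono f : x y / (x < y :> rat)} /\
  forall p : seq (rat * rat), order_pairing p ->
    exists k : nat, forall u, u \in p -> f (u.1 + k%:R) = u.2 + k%:R :> rat.
Proof.
(* Every finite list of pairs is decoded from some [n], so countably many requirements cover all
   pairings. *)
pose R n (q : seq (rat * rat)) :=
  let p : seq (rat * rat) := @decode (seq (rat * rat)) [::] n in
  order_pairing p ->
  exists k : nat, {subset [seq (u.1 + k%:R, u.2 + k%:R) | u <- p] <= q}.
have [|f [g [fK gK f_mono fR]]] :=
    @back_and_forth _ _ rat rat (decode 0) (decode 0) R
      (@decode_surj _ 0) (@decode_surj _ 0) rat_dense rat_dense.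
  move=> n q qP; rewrite /R; set p : seq (rat * rat) := decode _ _.
  have [pP | pN] := pselect (order_pairing p); last first.
    by exists q; split=> // u.
  have [k kP] := order_pairing_shift_cat pP qP.
  exists ([seq (u.1 + k%:R, u.2 + k%:R) | u <- p] ++ q); split=> // [u uq|_].
    by rewrite mem_cat uq orbT.
  by exists k => u; rewrite mem_cat => ->.
exists (circ_aut fK gK (circb_mono f_mono)); split=> // p pP.
have [n np] := @decode_surj (seq (rat * rat)) [::] p.
have [q Rq fq] := fR n; have [|k kq] := Rq; first by rewrite np.
exists k => u up; rewrite /= (fq (u.1 + k%:R, u.2 + k%:R)) // kq // np.
by apply/mapP; exists u.
Qed.

Lemma exists_swap : exists (h : aut QC) (a b : rat),
  [/\ a < b, h a = b & h b = a].
Proof.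
have [|f [g [fK gK f_mono _]]] := @back_and_forth _ _ rat (bool *l rat)%type
  (decode 0) (decode (true, 0)) (fun _ _ => True)
  (@decode_surj _ 0) (@decode_surj _ _) rat_dense boolrat_dense.
  by move=> _ p pP; exists p; split=> // u.
pose h x := g (swap_copies (f x)).
have hK : cancel h h.
  by move=> x; rewrite /h gK /swap_copies /= negbK -surjective_pairing fK.
have hC x y z : circb (h x) (h y) (h z) = circb x y z.
  by rewrite -!(circb_mono f_mono) !gK circb_swap_copies.
(* The two exchanged points correspond to the zeros of the two copies. *)
exists (circ_aut hK hK hC), (g (false, 0)), (g (true, 0)).
by rewrite -f_mono /= /h !gK.
Qed.

(** * Generated subgroups and density *)

Section Generated.
Context (G : groupType) (S : set G).
Local Open Scope group_scope.

Lemma generated_sub x : S x -> generated S x.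
Proof. by move=> Sx H [_]; apply. Qed.

Lemma generated1 : generated S 1.
Proof. by move=> H [[]]. Qed.

Lemma generatedM x y : generated S x -> generated S y -> generated S (x * y).
Proof.
move=> Hx Hy H HS; case: (HS) => -[_ + _] _.
by apply; [exact: Hx | exact: Hy].
Qed.

Lemma generatedV x : generated S x -> generated S x^-1.
Proof. by move=> Hx H HS; case: (HS) => -[_ _ +] _; apply; exact: Hx. Qed.

Lemma generatedX x n : generated S x -> generated S (x ^+ n).
Proof.
move=> Hx; elim: n => [|n IHn]; first exact: generated1.
by rewrite expgS; exact: generatedM.
Qed.

End Generated.

(** As [M] is countable, elements of [S] that agree with [g] on the points of code below [n]
    converge pointwise to [g], hence enter every open set around [g]. *)
Lemma dense_agree (L : language) (M : structure L) (S : set (aut M)) :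
    (forall (g : aut M) (s : seq M),
      exists2 w, S w & forall x, x \in s -> w x = g x) ->
  dense S.
Proof.
move=> agree O [g Og] [V Vopen VO].
have /choice[w wP] n : exists w : aut M, S w /\
    forall x : M, (choice.pickle x < n)%N -> w x = g x.
  have [w Sw wg] := agree g (pmap choice.unpickle (iota 0 n)).
  exists w; split=> // x xn; apply: wg; rewrite mem_pmap; apply/mapP.
  by exists (choice.pickle x); rewrite ?choice.pickleK // mem_iota.
have w_cvg : ((fun n => aut_ptws (w n)) @ \oo --> aut_ptws g)%classic.
  apply/pointwise_cvgP => x; apply/discrete_cvg.
  exists (choice.pickle x).+1 => // n xn.
  exact: (wP n).2.
have [n _ /(_ n (leqnn n)) Vw] :
    (\forall n \near \oo, V (aut_ptws (w n)))%classic.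
  by apply: w_cvg; apply: open_nbhs_nbhs; split=> //; rewrite -VO in Og.
by exists (w n); split; [rewrite -VO | exact: (wP n).1].
Qed.

(** * From transitivity on increasing tuples to agreement on finite sets *)

Section HighlyTransitive.
Context (H : set (aut QC)).
Context (H1 : H 1%g).
Context (HM : forall g h, H g -> H h -> H (g * h)%g).
Context (HV : forall g, H g -> H g^-1%g).
Context (H_pairing : forall p : seq (rat * rat), order_pairing p ->
  exists v : aut QC, [/\ H v, {mono v : x y / (x < y :> rat)} &
    forall u, u \in p -> v u.1 = u.2]).
Context (h : aut QC) (a b : rat).
Context (Hh : H h) (ab : a < b) (ha : h a = b) (hb : h b = a).

(* [h] maps each point outside the interval from [a] to [b] above [h b], so it
   is enough to move [m] to [b] and the other points of [s] out of the interval
   by an increasing map. *)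
Lemma minimize (s : seq rat) (m : rat) :
  exists2 w : aut QC, H w & forall x, x \in s -> x != m -> (w m : rat) < w x.
Proof.
(* The point [q] separates [m] from the points of [s] below it; sending [q] to [a] pushes those
   points below [a]. *)
have [|q [sq qm]] := interpolate (0 : rat)
    (l := [seq x <- s | x < m]) (r := [:: m]) rat_dense.
  by move=> x y; rewrite mem_filter inE => /andP[xm _] /eqP->.
have {}qm : q < m by apply: qm; rewrite inE.
have [|v [Hv v_mono vP]] := H_pairing (p := [:: (q, a); (m, b)]).
  by move=> u w; rewrite !inE => /pred2P[]-> /pred2P[]-> /=;
    rewrite ?ltxx ?qm ?ab ?(lt_gtF qm) ?(lt_gtF ab).
have vq : v q = a := vP (q, a) (mem_head _ _).
have vm : v m = b by apply: (vP (m, b)); rewrite !inE eqxx orbT.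
exists (h * v)%g => [|x xs xm]; first exact: HM.
rewrite /= vm hb.
have: circb (v x : rat) a b || circb a b (v x : rat).
  rewrite /circb ab; case: (ltgtP x m) xm => // [x_m | m_x] _.
    suff -> : (v x : rat) < a by [].
    by rewrite -vq v_mono; apply: sq; rewrite mem_filter x_m.
  have -> : b < v x by rewrite -vm v_mono.
  by rewrite !orbT.
(* As [h] exchanges [a] and [b] and preserves the circular order, the image of [v x] falls strictly
   between [a] and [b]. *)
rewrite -(aut_circb h) -(aut_circb h a) ha hb.
rewrite /circb (lt_gtF ab) /= !andbF !orbF /=.
by case/orP=> [|/andP[]] //; case/andP.
Qed.

Lemma agree_on (g : aut QC) (s : seq rat) :
  exists2 w : aut QC, H w & forall x, x \in s -> w x = g x.
Proof.
case: s => [|m s]; first by exists 1%g.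
have [w1 Hw1 w1m] := minimize (m :: s) m.
have [w2 Hw2 w2m] := minimize [seq (g x : rat) | x <- m :: s] (g m).
have g_inj : injective g := can_inj (aut_funK g).
(* Here [w1] makes [m] least and [w2] makes [g m] least, so [p] is increasing; for [v] extending
   [p], [w2^-1 v w1] agrees with [g]. *)
pose p : seq (rat * rat) := [seq (w1 x : rat, w2 (g x) : rat) | x <- m :: s].
have [|v [Hv _ vp]] := H_pairing (p := p).
  move=> _ _ /mapP[x xs ->] /mapP[y ys ->] /=.
  have min1 z : z \in m :: s -> z != m -> (w1 m : rat) < w1 z by exact: w1m.
  have min2 z : z \in m :: s -> z != m -> (w2 (g m) : rat) < w2 (g z).
    move=> zs zm; apply: w2m; last by rewrite inj_eq.
    exact: (map_f (fun x => g x : rat)).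
  have [-> | ym] := eqVneq y m; have [-> | xm] := eqVneq x m.
  - by rewrite !ltxx.
  - by rewrite (lt_gtF (min1 x xs xm)) (lt_gtF (min2 x xs xm)).
  - by rewrite (min1 y ys ym) (min2 y ys ym).
  (* Both inequalities say that [circb m x y] holds. *)
  rewrite -(@circb_min _ _ (w1 m : rat)) ?(min1 x) ?(min1 y) // aut_circb.
  rewrite -(@circb_min _ _ (w2 (g m) : rat)) ?(min2 x) ?(min2 y) //.
  by rewrite !aut_circb.
exists (w2^-1 * (v * w1))%g => [|x xs].
  by apply: HM; [exact: HV | exact: HM].
have vx : v (w1 x) = w2 (g x).
  by apply: (vp (w1 x, w2 (g x))); apply/mapP; exists x.
by rewrite /= vx aut_funK.
Qed.

(** Once [w] puts [y] below [x], the pairing of [x] with [w y] and of [y] with [w x] is increasing;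
    undoing [w] leaves the exchange. *)
Lemma exchange (x y : rat) : x < y ->
  exists2 w : aut QC, H w & w x = y /\ w y = x.
Proof.
move=> xy; have [w Hw /(_ x) wyx] := minimize [:: x] y.
have {}wyx : (w y : rat) < w x by apply: wyx; rewrite ?inE // lt_eqF.
have [|v [Hv _ vp]] := H_pairing (p := [:: (x, w y); (y, w x)]).
  by move=> u u'; rewrite !inE => /pred2P[]-> /pred2P[]-> /=;
    rewrite ?ltxx ?xy ?wyx ?(lt_gtF xy) ?(lt_gtF wyx).
exists (w^-1 * v)%g; first by apply: HM; [exact: HV|].
have vx : v x = w y := vp (x, w y : rat) (mem_head _ _).
have vy : v y = w x by apply: (vp (y, w x : rat)); rewrite !inE eqxx orbT.
by rewrite /= vx vy !aut_funK.
Qed.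

End HighlyTransitive.

(** * Types and automorphisms *)

(** Induction on [f], with parameters moved along with variables; the quantifier case uses that [g]
    is onto. *)
Lemma sat_aut (L : language) (M : structure L) (P : Type) (p : P -> M)
    (g : aut M) n (f : formula L P n) (v : n.-tuple M) :
  sat (g \o p) f (map_tuple g v) <-> sat p f v.
Proof.
have evalg k (t : term P k) (u : k.-tuple M) :
    Defs.eval (g \o p) (map_tuple g u) t = g (Defs.eval p u t).
  by case: t => [i | c] //=; rewrite tnth_map.
elim: f v => {n} [n | n t u | n s ts | n f1 IH1 f2 IH2 | n f IH] v //=.
- by rewrite !evalg; split=> [/(can_inj (aut_funK g)) | ->].
- suff -> : map_tuple (Defs.eval (g \o p) (map_tuple g v)) ts =
      map_tuple g (map_tuple (Defs.eval p v) ts) by exact: aut_interp.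
  by apply: eq_from_tnth => i; rewrite !tnth_map evalg.
- by rewrite IH1 IH2.
split=> fP x.
  have := fP (g x); rewrite -IH; congr (sat _ _ _).
  by apply: val_inj.
rewrite -[x](aut_invK g).
have := fP (aut_inv g x); rewrite -IH; congr (sat _ _ _).
by apply: val_inj.
Qed.

Lemma eq_tp_aut (L : language) (M : structure L) n (g : aut M)
    (a : n.-tuple M) :
  eq_tp (map_tuple g a) a.
Proof.
(* There are no parameters over the empty set, so none are moved. *)
have gE : g \o @fsval M fset0 = @fsval M fset0.
  by apply/funext => -[x xP]; have := xP; rewrite in_fset0.
by apply/predeqP => f; rewrite /tp /= -{1}gE; exact: sat_aut.
Qed.

Lemma eq_tp_tnth (L : language) (M : structure L) n (a b : n.-tuple M)
    (i j : 'I_n) :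
  eq_tp a b -> tnth a i = tnth a j -> tnth b i = tnth b j.
Proof.
move=> ab; pose f := Eq L (Var (fset_sub_type (fset0 : {fset M})) i) (Var _ j).
by have /predeqP/(_ f)[+ _] := ab; apply.
Qed.

Lemma eq_tp_interp (L : language) (M : structure L) n (a b : n.-tuple M) s
    (i : (arity s).-tuple 'I_n) :
    eq_tp a b -> interp M s (map_tuple (tnth a) i) ->
  interp M s (map_tuple (tnth b) i).
Proof.
move=> ab.
pose f := Rel (map_tuple (@Var (fset_sub_type (fset0 : {fset M})) n) i).
have E (c : n.-tuple M) p : sat p f c = interp M s (map_tuple (tnth c) i).
  by rewrite /=; congr (interp M s _); apply: val_inj; rewrite /= -map_comp.
by have /predeqP/(_ f)[+ _] := ab; rewrite -2!(E _ (@fsval M fset0)).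
Qed.

(** * Rank at most 3, and no canonical independence relation *)

(** Serves both conclusions: density through [agree_on], and the equality of the types of [xy] and
    [yx] through [exchange]. *)
Lemma exists_generators : exists t f h : aut QC,
  let H := generated [set` [:: t; f; h]] in
  (forall p : seq (rat * rat), order_pairing p ->
    exists v : aut QC, [/\ H v, {mono v : x y / (x < y :> rat)} &
      forall u, u \in p -> v u.1 = u.2]) /\
  exists a b : rat, [/\ a < b, h a = b & h b = a].
Proof.
have [f [f_mono f_shift]] := exists_shift_universal.
have [h [a [b hab]]] := exists_swap.
exists shift_aut, f, h => H; split; last by exists a, b.
have Ht : H shift_aut by apply: generated_sub; rewrite /= inE eqxx.
have Hf : H f by apply: generated_sub; rewrite /= !inE eqxx orbT.
move=> p /f_shift[k fk].
have unshift (x : rat) : aut_inv (shift_aut ^+ k)%g x = x - k%:R :> rat.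
  by rewrite -[x in LHS](subrK k%:R) -shift_autX aut_funK.
exists (shift_aut ^- k * (f * shift_aut ^+ k))%g; split.
- apply: generatedM; first by apply: generatedV; apply: generatedX.
  by apply: generatedM => //; apply: generatedX.
- by move=> x y; rewrite /= !unshift ltrD2r f_mono !shift_autX ltrD2r.
- by move=> u up; rewrite /= shift_autX fk // unshift addrK.
Qed.

Lemma QC_rank : topological_rank_le (aut QC) 3.
Proof.
have [t [f [h [H_pairing [a [b [ab ha hb]]]]]]] := exists_generators.
exists [:: t; f; h]; split=> //; apply: dense_agree => g s.
apply: (agree_on _ _ _ H_pairing _ ab ha hb).
- exact: generated1.
- exact: generatedM.
- exact: generatedV.
- by apply: generated_sub; rewrite /= !inE eqxx !orbT.
Qed.

Lemma eq_tp_swap (x y : rat) : eq_tp [tuple x : QC; y] [tuple y : QC; x].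
Proof.
wlog xy : x y / x < y.
  move=> hyp; case: (ltgtP x y) => [||->] // lt; first exact: hyp.
  exact/esym/hyp.
have [t [f [h [H_pairing [a [b [ab ha hb]]]]]]] := exists_generators.
have [|||w _ [wx wy]] := exchange _ _ H_pairing _ ab ha hb xy.
- exact: generatedM.
- exact: generatedV.
- by apply: generated_sub; rewrite /= !inE eqxx !orbT.
have <- : map_tuple w [tuple x : QC; y] = [tuple y : QC; x].
  by apply: val_inj; rewrite /= wx wy.
exact/esym/eq_tp_aut.
Qed.

Lemma QC_no_CIR (indep : {fset QC} -> {fset QC} -> {fset QC} -> Prop) :
  ~ is_CIR QC indep.
Proof.
case=> _ stat ext _ _ _ exist.
pose c : QC := (0 : rat).
(* Extension starts from the independence of [c] from the empty set; the pair [0, 1] only ensures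
   that [d'] consists of two distinct points. *)
have [d' [d'_tp ind]] := ext _ _ _ (exist [fset c]%fset fset0).1 2
  [tuple (0 : rat) : QC; (1 : rat)].
move: d'_tp ind; rewrite !fset0U.
case: d' => -[|x [|y []]] // sz d'_tp ind.
have xy : x != y :> rat.
  apply/eqP => xy; have := @eq_tp_tnth _ QC _ _ _ ord0 (lift ord0 ord0) d'_tp.
  by rewrite !(tnth_nth (0 : rat)) /= => /(_ xy).
(* Independence concerns sets, so [ind] serves for both enumerations of the pair. *)
have rangeS : tuple_range [tuple y; x] = tuple_range (Tuple sz).
  by apply/fsetP => z; rewrite /tuple_range !inE /= !orbF orbC.
have range1 : tuple_range [tuple c] = [fset c]%fset.
  by apply/fsetP => z; rewrite /tuple_range !inE /= orbF.
have sxy : Tuple sz = [tuple x; y] by apply: val_inj.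
have := stat _ _ _ _ 1 2 [tuple c] [tuple c] (Tuple sz) [tuple y; x] ind ind
  range1 erefl range1 rangeS erefl.
rewrite sxy => /(_ (eq_tp_swap x y)) cxy_cyx.
pose i1 : 'I_3 := lift ord0 ord0; pose i2 : 'I_3 := ord_max.
(* If [c = x], the equality of types of [cxy] and [cyx] gives [c = y], against [x != y]. *)
have cx : c != x :> rat.
  apply: contraNneq xy => cx.
  have := @eq_tp_tnth _ QC 3 _ _ ord0 i1 cxy_cyx.
  by rewrite !(tnth_nth (0 : rat)) /= => /(_ cx) <-; rewrite cx.
have cy : c != y :> rat.
  apply: contraNneq xy => cy.
  have := @eq_tp_tnth _ QC 3 _ _ ord0 i2 cxy_cyx.
  by rewrite !(tnth_nth (0 : rat)) /= => /(_ cy) <-; rewrite cy.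
have circ_flip (u v : 3.-tuple QC) : eq_tp u v ->
    circ (tnth u ord0) (tnth u i1) (tnth u i2) ->
    circ (tnth v ord0) (tnth v i1) (tnth v i2).
  move=> /(@eq_tp_interp _ QC 3 u v tt [tuple ord0; i1; i2]).
  by rewrite /= !tnth_map.
have := circ_flip _ _ cxy_cyx; have := circ_flip _ _ (esym cxy_cyx).
rewrite !(tnth_nth (0 : rat)) /= !circP circb_total ?(eq_sym y) //.
by case: circb => [_ /(_ isT) | /(_ isT)].
Qed.

Theorem corollary5p7 :
  topological_rank_le (aut QC) 3 /\
  ~ exists indep : {fset QC} -> {fset QC} -> {fset QC} -> Prop,
      is_CIR QC indep.
Proof. by split; [exact: QC_rank | case=> indep; exact: QC_no_CIR]. Qed.
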